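(* Let $G\curvearrowright X$ be a continuous action of a countable group on a compact metrizable space. Then the following are equivalent: \begin{enumerate} \item[(1)] the action $G\curvearrowright X$ has the SBP and no finite orbits; \item[(2)] for every continuous action $H\curvearrowright Y$ of a countable group on a compact metrizable space, the product action $G\times H\curvearrowright X\times Y$ has the SBP. \end{enumerate} In particular, condition (2) holds whenever $G$ is infinite and the action $G\curvearrowright X$ is minimal and has the SBP.
   Context: For a continuous action $G\curvearrowright X$ of a countable group on a compact metrizable space, $\mathcal{M}_G(X)$ denotes the set of all $G$-invariant Borel probability measures on $X$ (possibly empty). A Borel set $B\subseteq X$ is $\mathcal{M}_G(X)$-small if $\mu(B)=0$ for every $\mu\in\mathcal{M}_G(X)$. The action $G\curvearrowright X$ has the small boundary property (SBP) if there is a basis for the topology of $X$ consisting of open sets whose boundary is $\mathcal{M}_G(X)$-small. The product action $G\times H\curvearrowright X\times Y$ is defined by $(g,h)(x,y)=(gx,hy)$, and its SBP is understood with respect to the $G\times H$-invariant Borel probability measures on $X\times Y$. An action is minimal if every orbit is dense.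
   Formalization: In the final ''in particular'' sentence X is additionally assumed infinite, since the claim fails for finite nonempty X (e.g. an infinite G acting trivially on a point, with H trivial and Y=[0,1]); the equivalence of (1) and (2) is unchanged. *)

(* Defs.v *)
From HB Require Import structures.
From mathcomp Require Import all_boot all_order all_algebra.
From mathcomp Require Import all_classical all_reals all_analysis.

Set Implicit Arguments.
Unset Strict Implicit.
Unset Printing Implicit Defensive.

Import Order.TTheory GRing.Theory Num.Theory.

Local Open Scope classical_set_scope.
Local Open Scope ring_scope.

(* Nonnegativity of [d] follows from the first three clauses. *)
Definition metrizable (R : realType) (X : topologicalType) : Prop :=
  exists d : X -> X -> R,
    [/\ forall x y, d x y = 0 <-> x = y,
        forall x y, d x y = d y x,
        forall x y z, d x z <= d x y + d y z
      & forall x : X,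
          nbhs x = filter_from [set e : R | 0 < e]
                               (fun e => [set y | d x y < e])].

Definition compact_metrizable (R : realType) (X : topologicalType) : Prop :=
  compact [set: X] /\ metrizable R X.

(* The groups are discrete, so continuity of an action is continuity of each
   translation. *)
Record continuous_action (G : groupType) (X : topologicalType) := ContAction {
  act :> G -> X -> X ;
  act1 : forall x, act 1%g x = x ;
  actM : forall g h x, act (g * h)%g x = act g (act h x) ;
  act_continuous : forall g, continuous (act g) }.

Section product_action.
Variables (G H : groupType) (X Y : topologicalType).
Variables (a : continuous_action G X) (b : continuous_action H Y).

Definition prod_act (gh : G * H) (xy : X * Y) : X * Y :=
  (a gh.1 xy.1, b gh.2 xy.2).

Lemma prod_act1 xy : prod_act 1%g xy = xy.
Proof. by case: xy => x y; rewrite /prod_act /= !act1. Qed.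

Lemma prod_actM gh gh' xy :
  prod_act (gh * gh')%g xy = prod_act gh (prod_act gh' xy).
Proof. by rewrite /prod_act /= !actM. Qed.

Lemma prod_act_continuous gh : continuous (prod_act gh).
Proof.
move=> xy; apply: cvg_pair => /=.
  by apply: (cvg_comp _ _ cvg_fst); exact: act_continuous.
by apply: (cvg_comp _ _ cvg_snd); exact: act_continuous.
Qed.

Definition prod_action : continuous_action (G * H)%type (X * Y)%type :=
  ContAction prod_act1 prod_actM prod_act_continuous.

End product_action.

(* A [measurableType] must be pointed. In order not to exclude the empty space,
   the Borel space of [X] is parametrized by the distinguished point [x0]; its
   sigma-algebra does not depend on [x0], and there is no Borel probability
   measure on [X] when there is no [x0]. *)
Definition pointed_at (X : topologicalType) (x0 : X) : Type := X.
HB.instance Definition _ (X : topologicalType) (x0 : X) :=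
  Choice.on (pointed_at x0).
HB.instance Definition _ (X : topologicalType) (x0 : X) :=
  isPointed.Build (pointed_at x0) x0.

Notation Borel x0 := (g_sigma_algebraType (@open _ : set (set (pointed_at x0)))).

Section small_boundary.
Variables (R : realType) (G : groupType) (X : topologicalType).
Variable a : continuous_action G X.

Definition invariant_measures (x0 : X) :=
  [set mu : probability (Borel x0) R | forall (g : G) (A : set (Borel x0)),
     measurable A -> mu (a g @^-1` A) = mu A].

(* Only meaningful when [B] is Borel. *)
Definition small (B : set X) : Prop :=
  forall (x0 : X) (mu : probability (Borel x0) R),
    invariant_measures mu -> mu B = 0%E.

Definition boundary (U : set X) : set X := closure U `\` U°.

Definition small_boundary_property : Prop :=
  exists2 B : set (set X), basis B & forall U, B U -> small (boundary U).

Definition act_orbit (x : X) : set X := [set a g x | g in [set: G]].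

Definition no_finite_orbits : Prop := forall x, infinite_set (act_orbit x).

Definition minimal_action : Prop := forall x, dense (act_orbit x).

End small_boundary.

Definition products_have_SBP (R : realType) (G : groupType)
    (X : topologicalType) (a : continuous_action G X) : Prop :=
  forall (H : groupType) (Y : topologicalType) (b : continuous_action H Y),
    countable [set: H] -> compact_metrizable R Y ->
    small_boundary_property R (prod_action a b).

(* Main.v *)
Require Import Defs.
From HB Require Import structures.
From mathcomp Require Import all_boot all_order all_algebra.
From mathcomp Require Import all_classical all_reals all_analysis.
From mathcomp Require Import fingroup perm finmap ring lra.

Set Implicit Arguments.
Unset Strict Implicit.
Unset Printing Implicit Defensive.

Import Order.TTheory GRing.Theory Num.Theory.
Import numFieldNormedType.Exports.

Local Open Scope classical_set_scope.
Local Open Scope ring_scope.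

(** Sufficiency. Write [M] for the set of invariant Borel probability
    measures of [a]. An invariant measure [nu] of the product action is in
    particular invariant under [G] acting on the first coordinate. Hence, for
    every subset [E] of [Y] such that [X * E] is Borel of positive mass,
    conditioning [nu] on [X * E] and projecting to [X] gives an element of [M]
    ([product_fst_conditional]). No disintegration is needed after that.

    Let [d] be a metric on [Y]. Around a point [(x, y)], take
    [U = {(u, v) | u in V, d y v < phi u}], where [V] is a neighborhood of [x]
    with small boundary and [phi : X -> R] is continuous, positive and bounded
    by a small [r]. The boundary of [U] lies
    in the union of [boundary V * Y], which is null, and of the graph-like set
    [L = {(u, v) | phi u = d y v}]. The set [L] is null as soon as [phi] is
    diffuse: for every [eps] there is [delta] such that every set
    [{|phi - t| < delta}] has mass at most [eps] for every measure in [M].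
    Indeed, cut [Y] into the pieces [E_n = {n delta <= d y v < (n + 1) delta}]:
    the part of [L] above [E_n] projects into such a set, so it has mass at
    most [eps * nu (X * E_n)], and these bounds add up to at most [eps]
    ([diffuse_graph_null]).

    A diffuse [phi] exists near any continuous function ([diffuse_function]).
    Without finite orbits, the measures in [M] have no atoms. By compactness of
    [M], every point then has a neighborhood which is uniformly small for [M],
    and, by the SBP, one with a small boundary. Cover [X] by finitely many of
    these, replace the given function by distinct nearby constants on the
    pieces of the resulting partition, and interpolate near the boundaries,
    which have a uniformly small neighborhood ([diffuse_perturbation]). Do this
    again and again with smaller and smaller perturbations and pass to the
    limit.

    Compactness of [M] is used only through [uniformly_small_nbhs]: a closed
    set of mass less than [e] for all measures in [M] has an open neighborhood
    with the same property. Otherwise, the masses of closed sets under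
    a family of counterexamples converge along an ultrafilter to a content,
    which extends to a Borel measure by Caratheodory's theorem
    ([Radon_probability]); this limit is in [M] and contradicts the hypothesis.

    Necessity. Let [Y] be the extended real line with a trivial action.
    Slices of a basis of [X * Y] at a fixed [y] give a basis of [X] with small
    boundaries ([products_have_SBP_factor]). If the orbit of [x] were finite,
    then each set [orbit * {y}] would carry an invariant probability measure,
    so that [(x, y)] is never in a small boundary: the slice at [x] of
    an open set with small boundary is then clopen in [Y], which contradicts
    the connectedness of [Y].

    Minimality excludes finite orbits in an infinite [X], since a finite orbit
    is closed. *)

(** * Preliminaries *)

(** The finite subcover property, for spaces that may be empty. *)
Lemma compact_cover_compact (X : topologicalType) (K : set X) :
  compact K -> cover_compact K.
Proof.
move=> cK; have [->|/set0P[x0 _]] := eqVneq K set0.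
  by move=> I D f _ _; exists fset0.
pose X' : ptopologicalType := HB.pack X (isPointed.Build X x0).
have E := @compact_cover X'.
have : @cover_compact X' K by rewrite -E.
exact.
Qed.

Lemma measure_le d (T : measurableType d) (R : realType)
    (mu : {measure set T -> \bar R}) (A B : set T) :
  measurable A -> measurable B -> A `<=` B -> (mu A <= mu B)%E.
Proof. by move=> mA mB AB; apply: le_measure => //; exact: mem_set. Qed.

(** A function with values in [[0, 1]] has a limit along every ultrafilter. *)
Lemma ultra_unit_cvg (R : realType) (I : Type) (U : set_system I) (u : I -> R) :
  UltraFilter U -> (forall i, 0 <= u i <= 1) -> exists l : R, u @ U --> l.
Proof.
move=> UU u01.
have cI : compact `[0%R, (1 : R)]%classic by exact: segment_compact.
have : (u @ U) `[0%R, 1%R]%classic.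
  by apply: (@filterE I U _) => i; rewrite /= in_itv; exact: u01.
move=> /cI [l [_ lU]]; exists l => A lA.
have [//|UnA] := in_ultra_setVsetC (u @^-1` A) UU.
have [x [nAx Ax]] := lU (~` A) A UnA lA.
by have := nAx Ax.
Qed.

(** Finitely many reals can be moved by less than [eta] so as to become
    separated by a positive gap. *)
Lemma spread_points (R : realType) (v : nat -> R) (eta : R) (n : nat) :
  0 < eta -> exists (c : nat -> R) (gap : R), [/\ 0 < gap,
    forall i, (i < n)%N -> `|c i - v i| < eta &
    forall i j, (i < n)%N -> (j < n)%N -> i <> j -> gap <= `|c i - c j|].
Proof.
move=> eta0; pose N := n.+1; pose g : R := eta / N%:R.
have N0 : 0 < N%:R :> R by rewrite ltr0n.
have g0 : 0 < g by rewrite divr_gt0.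
have gN : g * N%:R = eta by rewrite /g divfK// gt_eqF.
(* The [i]-th point is rounded down to a multiple of [eta = N * g] and then
   shifted by [i * g]: the integers [z i] differ modulo [N]. *)
pose z i : int := (Num.floor (v i / eta) * N%:Z + i%:Z)%R.
exists (fun i => g * (z i)%:~R), g; split => //.
  move=> i ni; have /andP[f1 f2] : (Num.floor (v i / eta))%:~R <= v i / eta <
      (Num.floor (v i / eta))%:~R + 1.
    by rewrite floor_le_tmp -intrD1 floorD1_gt.
  rewrite /z intrD intrM mulrDr mulrCA -!pmulrn gN.
  move: f1 f2; rewrite ler_pdivlMr// ltr_pdivrMr// => f1 f2.
  have i0 : 0 <= g * i%:R by rewrite mulr_ge0// ltW.
  have iN : g * i%:R < eta by rewrite -gN ltr_pM2l// ltr_nat ltnS ltnW.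
  rewrite ltr_norml; apply/andP; split; lra.
move=> i j ni nj ij; rewrite -mulrBr normrM gtr0_norm// ler_peMr//.
  exact: ltW.
rewrite -intrB -intr_norm -[1]/(1%:~R) ler_int.
have : z i - z j != 0.
  apply/eqP => zij; apply: ij.
  have : (z i %% N%:Z)%Z = (z j %% N%:Z)%Z by rewrite (subr0_eq zij).
  rewrite /z !modzMDl !modz_small ?ltz_nat ?ltnS ?(ltnW ni) ?(ltnW nj)//.
  by move=> [].
by rewrite -normr_gt0 -gtz0_ge1.
Qed.

(** Bijections preserve the counting measure. *)
Lemma counting_preimage (R : realType) (T : choiceType) (h h' : T -> T)
    (A : set T) :
  cancel h h' -> cancel h' h ->
  counting (h @^-1` A) = counting A :> \bar R.
Proof.
move=> hK h'K.
have -> : h @^-1` A = h' @` A.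
  apply/seteqP; split => [x Ax|_ [x Ax <-]]; last by rewrite /= h'K.
  by exists (h x).
rewrite /counting; have [finA|infA] := pselect (finite_set A); last first.
  rewrite !asboolF// => fin; apply: infA.
  have := finite_image h fin; rewrite image_comp.
  by rewrite (_ : h \o h' = id) ?image_id//; apply/funext => x /=; rewrite h'K.
rewrite !asboolT//; last exact: finite_image.
rewrite fset_set_image//; congr (_%:R%:E).
by rewrite card_imfset//; exact: can_inj h'K.
Qed.

Lemma counting_neq0 (R : realType) (T : choiceType) (A : set T) (x : T) :
  A x -> counting A != 0%E :> \bar R.
Proof.
move=> Ax; rewrite /counting; case: asboolP => [finA|//].
rewrite eqe pnatr_eq0 cardfs_eq0; apply/eqP => A0.
have : x \in fset_set A by rewrite in_fset_set//; exact: mem_set.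
by rewrite A0 inE.
Qed.

Lemma open_measurable_Borel (X : topologicalType) (x0 : X) (U : set X) :
  open U -> measurable (U : set (Borel x0)).
Proof. by move=> oU; exact: sub_sigma_algebra. Qed.

Lemma closed_measurable_Borel (X : topologicalType) (x0 : X) (K : set X) :
  closed K -> measurable (K : set (Borel x0)).
Proof.
move=> cK; rewrite -(setCK K); apply: (@measurableC _ (Borel x0)).
by apply: open_measurable_Borel; exact: closed_openC.
Qed.

Lemma continuous_preimage_measurable (X Z : topologicalType) (x0 : X) (z0 : Z)
    (f : X -> Z) : continuous f ->
  measurable_fun setT (f : Borel x0 -> Borel z0).
Proof.
move=> cf; apply: measurability => // _ [B oB <-]; rewrite setTI.
by apply: open_measurable_Borel; apply: open_comp.
Qed.

Lemma boundary_closed (X : topologicalType) (U : set X) : closed (boundary U).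
Proof.
apply: closedI; first exact: closed_closure.
by apply: open_closedC; exact: open_interior.
Qed.

Lemma boundary_preimage (X Z : topologicalType) (f : X -> Z) (U : set Z) :
  continuous f -> boundary (f @^-1` U) `<=` f @^-1` boundary U.
Proof.
move=> cf x [clx nx]; split.
  move=> N fxN; have [z [Uz Nz]] := clx _ (cf x N fxN).
  by exists (f z).
by move=> /cf fx; apply: nx.
Qed.

Section metric.
Context (R : realType) (X : topologicalType) (d : X -> X -> R).
Hypothesis d0 : forall x y, d x y = 0 <-> x = y.
Hypothesis dC : forall x y, d x y = d y x.
Hypothesis dD : forall x y z, d x z <= d x y + d y z.
Hypothesis dnbhs : forall x : X, nbhs x =
  filter_from [set e : R | 0 < e] (fun e => [set y | d x y < e]).

Lemma metric_ge0 x y : 0 <= d x y.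
Proof.
have := dD x y x; rewrite (d0 x x).2// [d y x]dC => h; lra.
Qed.

Lemma metric_ball_nbhs x e : 0 < e -> nbhs x [set y | d x y < e].
Proof. by move=> e0; rewrite dnbhs; exists e. Qed.

Lemma metric_hausdorff : hausdorff_space X.
Proof.
move=> p q pq; apply/d0/eqP; rewrite eq_le metric_ge0 andbT leNgt.
apply/negP => pq0.
have e0 : 0 < d p q / 2 by rewrite divr_gt0.
have [z [/= pz qz]] := pq _ _ (metric_ball_nbhs p e0) (metric_ball_nbhs q e0).
by have := dD p z q; rewrite [d z q]dC; lra.
Qed.

Lemma metric_continuous x : continuous (d x).
Proof.
move=> y; apply/cvgrPdist_lt => e e0.
apply: filterS (metric_ball_nbhs y e0) => z /= yz.
have := dD x y z; have := dD x z y; rewrite [d z y]dC => h1 h2.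
by rewrite ltr_norml; apply/andP; split; lra.
Qed.

End metric.

Lemma metrizable_hausdorff (R : realType) (X : topologicalType) :
  metrizable R X -> hausdorff_space X.
Proof. by move=> [d [d0 dC dD dnbhs]]; exact: metric_hausdorff d0 dC dD dnbhs. Qed.

(** * Radon measures from contents on closed sets *)

(** A content [m] on the closed subsets of a compact Hausdorff space extends to
    a Borel measure whose value on an open set [O] is the supremum of [m K]
    over the closed sets [K] included in [O]. The values of [m] on sets which
    are not closed play no role. *)
Section content_on_closed_sets.
Context (R : realType) (X : topologicalType) (x0 : X).
Hypothesis X_hausdorff : hausdorff_space X.
Hypothesis X_compact : compact [set: X].
Variable m : set X -> R.
Hypothesis m0 : m set0 = 0.
Hypothesis m_le : forall K L, closed K -> closed L -> K `<=` L -> m K <= m L.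
Hypothesis m_subU : forall K L, closed K -> closed L ->
  m (K `|` L) <= m K + m L.
Hypothesis m_U : forall K L, closed K -> closed L -> K `&` L = set0 ->
  m (K `|` L) = m K + m L.

Local Notation T := (Borel x0).

(** The inner approximation of a set by closed sets, according to [m]. *)
Definition inner_content (O : set X) : \bar R :=
  ereal_sup [set (m K)%:E | K in [set K | closed K /\ K `<=` O]].

Local Notation rho := inner_content.

Lemma inner_content_ge O K : closed K -> K `<=` O -> ((m K)%:E <= rho O)%E.
Proof. by move=> cK KO; apply: ereal_sup_ubound; exists K. Qed.

Lemma inner_content_ge0 O : (0 <= rho O)%E.
Proof.
rewrite -[leLHS]/(0%:E) -m0.
by apply: inner_content_ge => //; exact: closed0.
Qed.

Lemma le_inner_content O P : O `<=` P -> (rho O <= rho P)%E.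
Proof.
move=> OP; apply: ereal_sup_le => _ [K [cK KO] <-]; exists K => //.
by split => //; exact: subset_trans OP.
Qed.

Lemma inner_content_le_setT O : (rho O <= (m setT)%:E)%E.
Proof.
apply: ge_ereal_sup => _ [K [cK _] <-]; rewrite lee_fin.
by apply: m_le => //; exact: closedT.
Qed.

Lemma inner_content0 : rho set0 = 0%E.
Proof.
apply/eqP; rewrite eq_le inner_content_ge0 andbT.
by apply: ge_ereal_sup => _ [K [_ + <-]]; rewrite subset0 => ->; rewrite m0.
Qed.

Lemma inner_content_setT : rho setT = (m setT)%:E.
Proof.
apply/eqP; rewrite eq_le inner_content_le_setT inner_content_ge//.
Qed.

Lemma closed_cover2 (K U V : set X) :
  closed K -> open U -> open V -> K `<=` U `|` V ->
  exists K1 K2, [/\ closed K1, closed K2, K1 `<=` U, K2 `<=` V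
    & K = K1 `|` K2].
Proof.
move=> cK oU oV KUV.
have nX := compact_normal X_hausdorff X_compact.
have c1 : closed (K `\` V) by apply: closedI => //; exact: open_closedC.
have /(nX _ c1) [P /set_nbhsP[P' [oP' KP' PP'] clP]] : set_nbhs (K `\` V) U.
  by apply/set_nbhsP; exists U; split => // x [/KUV[]//].
exists (K `&` closure P), (K `\` P'); split.
- by apply: closedI => //; exact: closed_closure.
- by apply: closedI => //; exact: open_closedC.
- by move=> x [_ /clP].
- move=> x [Kx P'x]; apply: contrapT => Vx; apply: P'x; exact: KP'.
- apply/seteqP; split => [x Kx|x [[]|[]]//].
  have [P'x|nP'x] := pselect (P' x); [left|by right].
  by split => //; apply: subset_closure; exact: PP'.
Qed.

Lemma content_le_sum (O : nat -> set X) n K : (forall k, open (O k)) ->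
  closed K -> K `<=` \big[setU/set0]_(k < n) O k ->
  ((m K)%:E <= \sum_(k < n) rho (O k))%E.
Proof.
move=> oO; elim: n K => [|n IH] K cK.
  by rewrite !big_ord0 subset0 => ->; rewrite m0.
rewrite !big_ord_recr /= => KO.
have oU : open (\big[setU/set0]_(k < n) O k).
  by rewrite -bigcup_mkord; apply: bigcup_open => i _.
have [K1 [K2 [c1 c2 K1O K2O ->]]] := closed_cover2 cK oU (oO n) KO.
apply: (@le_trans _ _ ((m K1)%:E + (m K2)%:E)%E).
  by rewrite -EFinD lee_fin; exact: m_subU.
by apply: leeD; [exact: IH|exact: inner_content_ge].
Qed.

Lemma content_le_series (O : nat -> set X) K : (forall k, open (O k)) ->
  closed K -> K `<=` \bigcup_k O k ->
  ((m K)%:E <= \sum_(k <oo) rho (O k))%E.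
Proof.
move=> oO cK KO.
have : cover_compact K.
  by apply: compact_cover_compact; exact: subclosed_compact X_compact _.
move=> /(_ nat setT O (fun k _ => oO k)) [].
  by move=> x /KO [k _ Okx]; exists k.
move=> D _ KD; pose n := (\max_(i <- enum_fset D) i).+1.
have KN : K `<=` \big[setU/set0]_(k < n) O k.
  move=> x /KD[k /= kD Okx]; rewrite -bigcup_mkord; exists k => //=.
  by rewrite /n ltnS; apply: (@leq_bigmax_seq _ _ xpredT id).
apply: le_trans (content_le_sum oO cK KN) _.
rewrite -(big_mkord xpredT (rho \o O)).
by apply: nneseries_lim_ge => k _ _; exact: inner_content_ge0.
Qed.

(** The inner content on open sets, and [+oo] on other sets, so that only the
    covers by open sets matter in the outer measure below. *)
Definition open_content (A : set T) : \bar R :=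
  if `[< open (A : set X) >] then rho A else +oo%E.

Let open_content0 : open_content set0 = 0%E.
Proof.
rewrite /open_content asboolT ?inner_content0//; exact: open0.
Qed.

Let open_content_ge0 A : (0 <= open_content A)%E.
Proof. by rewrite /open_content; case: ifP => // _; exact: inner_content_ge0. Qed.

(** The outer measure of covers by countably many open sets. *)
Definition open_outer (A : set T) : \bar R := mu_ext open_content A.

Local Notation om := open_outer.

HB.instance Definition _ := isOuterMeasure.Build R T om
  (mu_ext0 open_content0 open_content_ge0)
  (mu_ext_ge0 open_content_ge0)
  (le_mu_ext open_content)
  (mu_ext_sigma_subadditive open_content_ge0).

Lemma outer_le_inner_content (O : set X) : open O -> (om O <= rho O)%E.
Proof.
move=> oO; apply: ereal_inf_lbound.
exists (fun k => if k is 0 then O else set0); first split.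
- by case=> [|k]; [exact: open_measurable_Borel|exact: measurable0].
- by move=> x Ox; exists 0%N.
- rewrite nneseries_recl//= [X in (_ + X)%E]eseries0 ?adde0.
    by rewrite /open_content asboolT.
  by move=> [|k].
Qed.

(** The outer measure is determined from above by open sets. *)
Lemma outer_ge (A : set X) (e : \bar R) :
  (forall W, open W -> A `<=` W -> (e <= rho W)%E) -> (e <= om A)%E.
Proof.
move=> AW; apply: le_ereal_inf_tmp => _ [F [mF AF] <-].
have [oF|] := pselect (forall k, open (F k : set X)); last first.
  move=> /existsNP[k nFk]; rewrite (@eseries_pinfty _ _ _ k) ?leey//.
  - by move=> n _; apply/eqP => E; have := open_content_ge0 (F n); rewrite E.
  - by rewrite /open_content asboolF.
have oU : open (\bigcup_k (F k : set X)) by exact: bigcup_open.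
apply: le_trans (AW _ oU AF) _.
apply: ge_ereal_sup => _ [K [cK KF] <-].
apply: le_trans (content_le_series oF cK KF) _.
apply: lee_nneseries => k *; first exact: inner_content_ge0.
by rewrite /open_content asboolT//; exact: oF.
Qed.

Lemma outer_openE (O : set X) : open O -> om O = rho O.
Proof.
move=> oO; apply/eqP; rewrite eq_le outer_le_inner_content//=.
by apply: outer_ge => W _; exact: le_inner_content.
Qed.

Lemma outer_fin O : om O \is a fin_num.
Proof.
rewrite ge0_fin_numE ?mu_ext_ge0//.
apply: (@le_lt_trans _ _ (om setT)); first exact: le_mu_ext.
rewrite outer_openE; last exact: openT.
by rewrite inner_content_setT ltry.
Qed.

(** For [A] covered by an open [W], approximate [W] inside [O] from within by
    a closed [K], and the open set [W] minus [K] from within by a closed [L]: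
    then [K] and [L] are disjoint and included in [W]. *)
Lemma open_caratheodory (O : set X) : open O -> om.-caratheodory O.
Proof.
move=> oO; apply: le_caratheodory_measurable => A.
apply: outer_ge => W oW AW.
apply: (@le_trans _ _ (om (W `&` O) + om (W `&` ~` O))%E).
  by apply: leeD; apply: le_mu_ext; exact: setSI.
rewrite -leeBrDr ?outer_fin// outer_openE; last exact: openI.
apply: ge_ereal_sup => _ [K [cK KO] <-].
rewrite leeBrDr ?outer_fin// addeC -leeBrDr//.
apply: (@le_trans _ _ (rho (W `\` K))).
  rewrite -outer_openE; last by apply: openI => //; exact: closed_openC.
  by apply: le_mu_ext => x [Wx nOx]; split => // /KO[].
apply: ge_ereal_sup => _ [L [cL LW] <-].
rewrite leeBrDr// -EFinD -m_U//; last first.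
  by apply/seteqP; split => // x [/LW[]].
apply: inner_content_ge; first exact: closedU.
by move=> x [/LW[]|/KO[]].
Qed.

(** The Borel measure extending [m]; its restriction to Borel sets is a measure,
    but it is defined by the same formula on all sets. *)
Definition Radon_measure (A : set T) : \bar R := om A.

Let Radon_measure_sigma_additive : semi_sigma_additive Radon_measure.
Proof.
have sub (B : set T) : measurable B -> om.-cara.-measurable B.
  apply: (@smallest_sub _ (sigma_algebra setT)).
  - exact: sigma_algebra_measurable.
  - by move=> O; exact: open_caratheodory.
move=> F mF tF mUF.
apply: (@caratheodory_measure_sigma_additive R _ om) => //.
- by move=> k; apply: sub.
- exact: sub.
Qed.

HB.instance Definition _ := isMeasure.Build _ T R Radon_measure
  (mu_ext0 open_content0 open_content_ge0)
  (mu_ext_ge0 open_content_ge0)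
  Radon_measure_sigma_additive.

Lemma Radon_measure_openE (O : set X) : open O -> Radon_measure O = rho O.
Proof. exact: outer_openE. Qed.

Lemma Radon_measure_ge (A : set X) (e : \bar R) :
  (forall W, open W -> A `<=` W -> (e <= rho W)%E) -> (e <= Radon_measure A)%E.
Proof. exact: outer_ge. Qed.

Let inner_content_preimage (h : X -> X) (O : set X) :
  continuous h -> (forall K, closed K -> m (h @^-1` K) = m K) ->
  (rho O <= rho (h @^-1` O))%E.
Proof.
move=> ch mh; apply: ge_ereal_sup => _ [K [cK KO] <-].
rewrite -mh//; apply: inner_content_ge; last by move=> x /KO.
by apply: preimage_closed => //; exact: ch.
Qed.

(** A homeomorphism [h] (with inverse [h']) that preserves [m] preserves the
    measure of every set. *)
Lemma Radon_measure_preimage (h h' : X -> X) (A : set X) :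
  cancel h h' -> cancel h' h -> continuous h -> continuous h' ->
  (forall K, closed K -> m (h @^-1` K) = m K) ->
  (forall K, closed K -> m (h' @^-1` K) = m K) ->
  Radon_measure (h @^-1` A) = Radon_measure A.
Proof.
have le (f f' : X -> X) (B : set X) :
  cancel f f' -> cancel f' f -> continuous f -> continuous f' ->
  (forall K, closed K -> m (f @^-1` K) = m K) ->
  (forall K, closed K -> m (f' @^-1` K) = m K) ->
  (Radon_measure B <= Radon_measure (f @^-1` B))%E.
  move=> fK f'K cf cf' mf mf'; apply: Radon_measure_ge => W oW BW.
  have oW' : open (f' @^-1` W) by apply: open_comp.
  apply: (@le_trans _ _ (Radon_measure (f' @^-1` W))).
    by apply: le_mu_ext => x Bx; apply: BW => /=; rewrite f'K.
  rewrite Radon_measure_openE//.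
  have := @inner_content_preimage f (f' @^-1` W) cf mf.
  rewrite -comp_preimage (_ : f' \o f = id) ?preimage_id//.
  by apply/funext => x /=; rewrite fK.
move=> hK h'K ch ch' mh mh'; apply/eqP; rewrite eq_le; apply/andP; split.
  apply: le_trans (le h' h (h @^-1` A) _ _ _ _ _ _) _ => //.
  rewrite -comp_preimage (_ : h \o h' = id) ?preimage_id//.
  by apply/funext => x /=; rewrite h'K.
exact: (le h h').
Qed.

Lemma Radon_probability : m setT = 1 ->
  exists mu : probability T R, forall A, mu A = Radon_measure A.
Proof.
move=> m1.
have mu1 : Radon_measure setT = 1%E.
  rewrite Radon_measure_openE; last exact: openT.
  by rewrite inner_content_setT m1.
pose P := Measure_isProbability.Build _ T R Radon_measure mu1.
pose mu : probability T R := HB.pack Radon_measure P.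
by exists mu.
Qed.

End content_on_closed_sets.

(** * Compactness of the set of invariant measures *)

Section invariant_measures.
Context (R : realType) (G : groupType) (X : topologicalType).
Context (a : continuous_action G X) (x0 : X).
Hypothesis X_hausdorff : hausdorff_space X.
Hypothesis X_compact : compact [set: X].

Local Notation T := (Borel x0).

Lemma act_inv_cancel g : cancel (a g) (a g^-1%g).
Proof. by move=> x; rewrite -actM mulVg act1. Qed.

Lemma act_cancel_inv g : cancel (a g^-1%g) (a g).
Proof. by move=> x; rewrite -actM mulgV act1. Qed.

(** A family of invariant probability measures has a limit along an ultrafilter,
    which is again invariant, and the masses of closed sets do not drop in the
    limit: if every neighborhood of [C] contains a closed set which
    has mass at least [e] along the ultrafilter, then [C] has mass at least [e]
    in the limit. *)
Lemma limit_invariant_measure (I : Type) (F : set_system I)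
    (M : I -> probability T R) : UltraFilter F ->
  (forall i, invariant_measures a (M i)) ->
  exists2 mu : probability T R, invariant_measures a mu &
    forall (C : set X) (e : R),
      (forall W, open W -> C `<=` W ->
        exists K, [/\ closed K, K `<=` W & \near F, (e%:E <= M F K)%E]) ->
      (e%:E <= mu C)%E.
Proof.
move=> UF Minv.
have Fp : ProperFilter F by exact: ultra_proper.
have Mfin i (K : set T) : closed (K : set X) ->
    M i K \is a fin_num /\ 0 <= fine (M i K) <= 1.
  move=> cK; have mK := closed_measurable_Borel cK.
  have MK : M i K \is a fin_num by exact: fin_num_measure.
  by split=> //; rewrite -!lee_fin fineK// measure_ge0 probability_le1.
(* Setting [u] to 0 on sets which are not closed makes it bounded, hence
   convergent, on all sets. *)
pose u i (K : set T) : R := if `[< closed (K : set X) >] then fine (M i K) else 0.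
have u01 K i : 0 <= u i K <= 1.
  rewrite /u; case: asboolP => [cK|_]; last by rewrite lexx ler01.
  exact: (Mfin i K cK).2.
have uE K i : closed (K : set X) -> u i K = fine (M i K).
  by move=> cK; rewrite /u asboolT.
have [m mE] : {m : set X -> R & forall K, u^~ K @ F --> m K}.
  by apply: (choice (P := fun K l => u^~ K @ F --> l)) => K;
     exact: ultra_unit_cvg.
have m0 : m set0 = 0.
  apply: cvg_unique (mE set0) _ => //.
  rewrite (_ : u^~ set0 = cst 0); first exact: cvg_cst.
  by apply/funext => i; rewrite uE ?measure0//; exact: closed0.
have le_cvg (f g : I -> R) k l : f @ F --> k -> g @ F --> l ->
    (forall i, f i <= g i) -> k <= l.
  move=> fk gl fg; rewrite -subr_ge0; apply: cvgr_to_ge (cvgB gl fk) _.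
  by apply: nearW => i; rewrite /= subr_ge0.
have m_le K L : closed K -> closed L -> K `<=` L -> m K <= m L.
  move=> cK cL KL; apply: (le_cvg _ _ _ _ (mE K) (mE L)) => i; rewrite !uE//.
  rewrite fine_le ?(Mfin i K cK).1 ?(Mfin i L cL).1//.
  by apply: measure_le => //; exact: closed_measurable_Borel.
have cvgU K L : u^~ K \+ u^~ L @ F --> m K + m L by exact: cvgD.
have m_subU K L : closed K -> closed L -> m (K `|` L) <= m K + m L.
  move=> cK cL; have cKL : closed (K `|` L) by exact: closedU.
  apply: (le_cvg _ _ _ _ (mE _) (cvgU K L)) => i /=; rewrite !uE// -lee_fin EFinD.
  rewrite !fineK ?(Mfin i K cK).1 ?(Mfin i L cL).1 ?(Mfin i _ cKL).1//.
  by apply: measureU2; exact: closed_measurable_Borel.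
have m_U K L : closed K -> closed L -> K `&` L = set0 ->
    m (K `|` L) = m K + m L.
  move=> cK cL KL; apply: cvg_unique (mE _) _ => //.
  have cKL : closed (K `|` L) by exact: closedU.
  suff -> : u^~ (K `|` L) = u^~ K \+ u^~ L by exact: cvgU.
  apply/funext => i /=; rewrite !uE//; apply: EFin_inj; rewrite EFinD.
  rewrite !fineK ?(Mfin i K cK).1 ?(Mfin i L cL).1 ?(Mfin i _ cKL).1//.
  by apply: measureU => //; exact: closed_measurable_Borel.
have m_inv g K : closed K -> m (a g @^-1` K) = m K.
  move=> cK; apply: cvg_unique (mE _) _ => //.
  have cgK : closed (a g @^-1` K).
    by apply: preimage_closed => // x _; exact: act_continuous.
  suff -> : u^~ (a g @^-1` K) = u^~ K by exact: mE.
  by apply/funext => i /=; rewrite !uE// Minv//; exact: closed_measurable_Borel.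
have mT : m setT = 1.
  apply: cvg_unique (mE setT) _ => //.
  rewrite (_ : u^~ setT = cst 1); first exact: cvg_cst.
  by apply/funext => i; rewrite uE ?probability_setT//; exact: closedT.
have [mu muE] := Radon_probability x0 X_hausdorff X_compact m0 m_le m_subU m_U mT.
exists mu.
  move=> g A mA; rewrite !muE.
  exact: (Radon_measure_preimage x0 X_hausdorff X_compact m0 m_subU A
    (@act_inv_cancel g) (@act_cancel_inv g)
    (@act_continuous _ _ a g) (@act_continuous _ _ a g^-1%g)
    (@m_inv g) (@m_inv g^-1%g)).
move=> C e CW; rewrite muE.
apply: (Radon_measure_ge x0 X_hausdorff X_compact m0 m_subU) => W oW CsW.
have [K [cK KW Fe]] := CW _ oW CsW.
apply: le_trans (inner_content_ge m cK KW); rewrite lee_fin.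
apply: cvgr_to_ge (mE K) _.
apply: filterS Fe => i; rewrite uE// -lee_fin fineK//.
exact: (Mfin i K cK).1.
Qed.

(** The form of the compactness of the set of invariant probability measures
    used below. *)
Lemma uniformly_small_nbhs (C : set X) (e : R) : closed C ->
  (forall mu : probability T R, invariant_measures a mu -> (mu C < e%:E)%E) ->
  exists O, [/\ open O, C `<=` O &
    forall mu : probability T R, invariant_measures a mu -> (mu O < e%:E)%E].
Proof.
move=> cC Ce; have [C0|/set0P C0] := eqVneq C set0.
  by exists C; split => //; rewrite C0; exact: open0.
apply: contrapT => /forallNP nO.
(* A counterexample is chosen for each neighborhood [W] of [C], and the limit
   is taken as [W] shrinks to [C]. *)
have bad (W : set X) : exists mu : probability T R, C `<=` W° ->
    invariant_measures a mu /\ (e%:E <= mu W°)%E.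
  have [CW|nCW] := pselect (C `<=` W°); last by exists (@dirac _ T x0 R).
  have /not_and3P[|//|/existsNP[mu /not_implyP[muinv /negP]]] := nO W°.
    by case; exact: open_interior.
  by rewrite -leNgt => emu; exists mu.
have [M Mb] := choice bad.
have M0 : exists mu : probability T R, invariant_measures a mu.
  by have [|minv _] := Mb setT; [rewrite interiorT|exists (M setT)].
have [mu0 mu0inv] := M0.
pose M' W := if `[< C `<=` W° >] then M W else mu0.
have PF : ProperFilter (set_nbhs C) := set_nbhs_pfilter C0.
have FF := powerset_filter_from_filter PF.
have [F [UF FsubU]] := ultraFilterLemma FF.
have M'inv W : invariant_measures a (M' W).
  by rewrite /M'; case: asboolP => // /Mb[].
have [mu muinv muC] := limit_invariant_measure UF M'inv.
have := Ce _ muinv; rewrite ltNge => /negP; apply; apply: muC => W oW CW.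
have nX := compact_normal X_hausdorff X_compact.
have /(nX _ cC) [P CP PW] : set_nbhs C W by apply/set_nbhsP; exists W; split.
exists (closure P); split => //; first exact: closed_closure.
apply: FsubU.
near=> V.
have CV : C `<=` V°.
  have /set_nbhsP [V' [oV' CV' V'V]] : set_nbhs C V.
    by near: V; exact: near_small_set.
  by apply: subset_trans CV' _; rewrite -open_subsetE.
rewrite /M' asboolT//.
have [_ /le_trans] := Mb _ CV; apply.
apply: measure_le.
- by apply: open_measurable_Borel; exact: open_interior.
- by apply: closed_measurable_Borel; exact: closed_closure.
- apply: subset_trans (@subset_closure _ P).
  apply: subset_trans (@interior_subset _ V) _.
  by near: V; exact: small_set_sub.
Unshelve. all: by end_near. Qed.

End invariant_measures.

(** * Diffuse functions *)

Section small_neighborhoods.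
Context (R : realType) (G : groupType) (X : topologicalType).
Context (a : continuous_action G X) (x0 : X).
Hypothesis X_hausdorff : hausdorff_space X.
Hypothesis X_compact : compact [set: X].

Local Notation T := (Borel x0).

Lemma closed_point (x : X) : closed [set x].
Proof. by apply: accessible_closed_set1; exact: hausdorff_accessible. Qed.

(** All the points of an orbit have the same mass, so the orbit of an atom is
    finite. *)
Lemma invariant_measure_atomless (mu : probability T R) (x : X) :
  infinite_set (act_orbit a x) -> invariant_measures a mu ->
  mu [set x] = 0%E.
Proof.
move=> infx muinv.
have mpt y : measurable ([set y] : set T).
  by apply: closed_measurable_Borel; exact: closed_point.
have fpt : mu [set x] \is a fin_num by exact: fin_num_measure.
set c := fine (mu [set x]).
have cE : mu [set x] = c%:E by rewrite fineK.
have c0 : 0 <= c by rewrite -lee_fin -cE.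
rewrite cE; congr EFin; apply/eqP; rewrite eq_le c0 andbT leNgt.
apply/negP => cgt0.
have mu_orbit y : act_orbit a x y -> mu [set y] = c%:E.
  move=> [g _ <-]; rewrite -cE -(muinv g [set a g x])//; congr (mu _).
  apply/seteqP; split=> [z /= |z ->//].
  by move=> /(congr1 (a g^-1%g)); rewrite !act_inv_cancel.
have [B Borb cardB] := infinite_set_fset (Num.truncn c^-1).+1 infx.
have [mB muB] : measurable ([set` B] : set T) /\
    mu [set` B] = (c *+ #|` B|)%:E.
  have : {subset enum_fset B <= act_orbit a x}.
    by move=> y yB; apply: mem_set; exact: Borb.
  rewrite (_ : [set` B] = [set` enum_fset B])//.
  have := fset_uniq B; elim: (enum_fset B) => [_ _|y s IH /= /andP[ys us] ss].
    by rewrite set_nil measure0.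
  have [ms mus] : measurable ([set` s] : set T) /\ mu [set` s] = (c *+ size s)%:E.
    by apply: IH => // w ws; apply: ss; rewrite inE ws orbT.
  have -> : [set` y :: s] = [set y] `|` [set` s].
    apply/seteqP; split => w /=; rewrite inE.
      by move=> /orP[/eqP ->|ws]; [left|right].
    by move=> [->|->]; rewrite ?eqxx// orbT.
  split; first exact: measurableU.
  have -> : (c *+ size (y :: s))%:E = (mu [set y] + mu [set` s])%E.
    rewrite mus mu_orbit ?mulrS//.
    by apply/set_mem/ss; rewrite inE eqxx.
  apply: measureU => //.
  by apply/seteqP; split => // w [/= -> ws]; rewrite ws in ys.
have : (mu [set` B] <= 1)%E by exact: probability_le1.
rewrite muB lee_fin leNgt => /negP; apply.
rewrite -mulr_natl -ltr_pdivrMr// mul1r.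
by apply: lt_le_trans (truncnS_gt _) _; rewrite ler_nat.
Qed.

Lemma small_neighborhood (x : X) (e : R) (N : set X) :
  small_boundary_property R a -> infinite_set (act_orbit a x) ->
  0 < e -> nbhs x N ->
  exists U : set X, [/\ open U, U x, U `<=` N, small R a (boundary U) &
    forall mu : probability T R, invariant_measures a mu -> (mu U < e%:E)%E].
Proof.
move=> [B [Bopen Bnbhs] Bsmall] infx e0 xN.
have pt_lt (mu : probability T R) : invariant_measures a mu ->
    (mu [set x] < e%:E)%E.
  by move=> muinv; rewrite (invariant_measure_atomless infx)// lte_fin.
have [W [oW xW We]] :=
  uniformly_small_nbhs X_hausdorff X_compact (@closed_point x) pt_lt.
have : nbhs x (N `&` W).
  by apply: filterI => //; apply: open_nbhs_nbhs; split => //; exact: xW.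
move=> /Bnbhs[U [BU Ux] UNW]; exists U; split => //.
- exact: Bopen.
- by move=> y /UNW[].
- exact: Bsmall.
- move=> mu muinv; apply: le_lt_trans (We _ muinv).
  apply: measure_le; try exact: open_measurable_Borel.
    by apply: open_measurable_Borel; exact: Bopen.
  by move=> y /UNW[].
Qed.

End small_neighborhoods.

Section diffuse_functions.
Context (R : realType) (G : groupType) (X : topologicalType).
Context (a : continuous_action G X) (x0 : X).
Hypothesis X_hausdorff : hausdorff_space X.
Hypothesis X_compact : compact [set: X].
Hypothesis a_SBP : small_boundary_property R a.
Hypothesis a_inf : no_finite_orbits a.

Local Notation T := (Borel x0).

(** The points where [phi] is [delta]-close to [t]. *)
Definition slab (phi : X -> R) (t delta : R) : set X :=
  [set x | `|phi x - t| < delta].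

Lemma open_slab (phi : X -> R) t delta : continuous phi -> open (slab phi t delta).
Proof.
move=> cphi.
rewrite (_ : slab _ _ _ = phi @^-1` [set y | `|y - t| < delta])//.
apply: open_comp; first by move=> x _; exact: cphi.
rewrite (_ : [set y | _] = ball t delta); first exact: ball_open.
by apply/seteqP; split => y; rewrite /ball /= distrC.
Qed.

(** The continuous functions [psi] such that all slabs of [psi] of some fixed
    width have mass at most [eps] are dense for the supremum distance. *)
Lemma diffuse_perturbation (phi : X -> R) (eta eps : R) :
  continuous phi -> 0 < eta -> 0 < eps ->
  exists (psi : X -> R) (delta : R),
  [/\ continuous psi, forall x, `|psi x - phi x| <= eta, 0 < delta &
    forall mu : probability T R, invariant_measures a mu ->
      forall t, (mu (slab psi t delta) <= eps%:E)%E].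
Proof.
move=> cphi eta0 eps0.
have eta2 : 0 < eta / 2 by rewrite divr_gt0.
have eps2 : 0 < eps / 2 by rewrite divr_gt0.
have small_nbhd (x : X) : exists U : set X, [/\ open U, U x,
    U `<=` slab phi (phi x) (eta / 2), small R a (boundary U) &
    forall mu : probability T R, invariant_measures a mu ->
      (mu U < (eps / 2)%:E)%E].
  apply: (@small_neighborhood _ _ _ _ x0 X_hausdorff X_compact x (eps / 2)
    (slab phi (phi x) (eta / 2)) a_SBP (@a_inf x) eps2).
  apply: open_nbhs_nbhs; split; first exact: open_slab.
  by rewrite /slab /= subrr normr0.
have [U UP] := choice small_nbhd.
have [D _ UD] : finite_subset_cover setT U [set: X].
  apply: compact_cover_compact => //; first by move=> x _; have [] := UP x.
  by move=> x _; exists x => //; have [] := UP x.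
pose s := enum_fset D; pose n := size s; pose pt i := nth x0 s i.
(* [idx x] is the index of the first set of the cover that contains [x], and [c]
   assigns separated values to the indices. *)
pose idx x := find (fun p => `[< U p x >]) s.
have idx_has x : has (fun p => `[< U p x >]) s.
  by have [p pD Upx] := UD x Logic.I; apply/hasP; exists p => //; exact/asboolP.
have idx_lt x : (idx x < n)%N by rewrite -has_find.
have idxU x : U (pt (idx x)) x by have /asboolP := nth_find x0 (idx_has x).
have [c [gap [gap0 cpt cgap]]] := spread_points (phi \o pt) n eta2.
have cphi_le x : `|c (idx x) - phi x| <= eta.
  have [_ _ /(_ x (idxU x)) + _ _] := UP (pt (idx x)).
  have /= := cpt _ (idx_lt x); rewrite /slab /= => h1 h2.
  rewrite (splitr eta) (_ : c (idx x) - phi x = (c (idx x) - phi (pt (idx x)))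
    + (phi (pt (idx x)) - phi x)); last by rewrite addrA subrK.
  by apply: le_trans (ler_normD _ _) _; rewrite ltW// ltrD// distrC.
pose C := \big[setU/set0]_(p <- s) boundary (U p).
have CP x : ~ C x -> forall p, p \in D -> ~ boundary (U p) x.
  by rewrite /C -bigcup_seq => nCx p pD px; apply: nCx; exists p.
have cC : closed C by apply: closed_bigsetU => p _; exact: boundary_closed.
have C0 (mu : probability T R) : invariant_measures a mu ->
    (mu C < (eps / 2)%:E)%E.
  move=> muinv; suff mu0 s' : mu (\big[setU/set0]_(p <- s') boundary (U p)) = 0%E.
    by rewrite /C mu0 lte_fin.
  elim: s' => [|p s' IH]; first by rewrite big_nil measure0.
  rewrite big_cons; apply/eqP; rewrite eq_le measure_ge0 andbT.
  have mb q : measurable (boundary (U q) : set T).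
    by apply: closed_measurable_Borel; exact: boundary_closed.
  have ms' : measurable (\big[setU/set0]_(q <- s') boundary (U q) : set T).
    apply: closed_measurable_Borel; apply: closed_bigsetU => q _.
    exact: boundary_closed.
  have <- : (mu (boundary (U p)) +
      mu (\big[setU/set0]_(q <- s') boundary (U q)) = 0)%E.
    by rewrite IH adde0; have [_ _ _ ->] := UP p.
  exact: measureU2 (mb p) ms'.
have [W [oW CW muW]] := uniformly_small_nbhs X_hausdorff X_compact cC C0.
have nX := compact_normal X_hausdorff X_compact.
have [h [ch h01 hC hW]] : exists h : X -> R, [/\ continuous h,
    forall x, 0 <= h x <= 1, forall x, C x -> h x = 0 &
    forall x, ~ W x -> h x = 1].
  have CW0 : C `&` ~` W = set0 by apply/seteqP; split => // x [/CW].
  have := (@normal_separatorP R X).1 nX C (~` W) cC (open_closedC oW) CW0.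
  move=> /(@uniform_separatorP _ R)[h [ch h01 hC hW]]; exists h; split => //.
  - by move=> x; have := h01 (h x); rewrite /= in_itv/=; apply; exists x.
  - by move=> x Cx; have := hC (h x); apply; exists x.
  - by move=> x Cx; have := hW (h x); apply; exists x.
(* [psi] is [c (idx x)] outside of [W], and [phi] on the boundaries, where [idx]
   may jump. *)
pose psi x := phi x + h x * (c (idx x) - phi x).
have psiW x : ~ W x -> psi x = c (idx x).
  by move=> nWx; rewrite /psi hW// mul1r addrC subrK.
(* off the boundaries, [idx] is locally constant *)
have idx_near x : ~ C x -> \forall y \near x, idx y = idx x.
  move=> nCx.
  suff : \forall y \near x, forall p, p \in D -> `[< U p y >] = `[< U p x >].
    apply: filterS => y yx; rewrite /idx; apply: eq_in_find => p; exact: yx.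
  have := @filter_bigI _ _ D
    (fun p => [set y | `[< U p y >] = `[< U p x >]]) (nbhs x) _.
  move=> H; have : nbhs x (\bigcap_(p in [set` D])
      [set y | `[< U p y >] = `[< U p x >]]).
    apply: H => p pD; have [oUp _ _ _ _] := UP p.
    have [Upx|nUpx] := pselect (U p x).
      have : nbhs x (U p) by exact: open_nbhs_nbhs.
      by apply: filterS => y Upy; rewrite /= !asboolT.
    have ncl : ~ closure (U p) x.
      by move=> clx; apply: (CP x nCx p pD); split => // /interior_subset.
    have : nbhs x (~` closure (U p)).
      by apply: open_nbhs_nbhs; split=> //; apply: closed_openC; exact: closed_closure.
    by apply: filterS => y ny; rewrite /= !asboolF// => /subset_closure.
  by apply: filterS => y Hy p pD; exact: Hy.
have cpsi : continuous psi.
  move=> x; have [Cx|nCx] := pselect (C x); last first.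
    have : (fun y => phi y + h y * (c (idx x) - phi y)) @ x --> psi x.
      apply: cvgD; first exact: cphi.
      apply: cvgM; first exact: ch.
      by apply: cvgB; [exact: cvg_cst|exact: cphi].
    apply: cvg_trans; apply: near_eq_cvg.
    by apply: filterS (idx_near x nCx) => y; rewrite /psi => ->.
  apply/cvgrPdist_lt => e e0.
  have e2 : 0 < e / 2 by rewrite divr_gt0.
  have e3 : 0 < e / 2 / eta by rewrite divr_gt0.
  near=> y.
  have phiy : `|phi x - phi y| < e / 2.
    by near: y; apply: (@cvgr_dist_lt _ R^o) e2; exact: cphi.
  have : `|h x - h y| < e / 2 / eta.
    by near: y; apply: (@cvgr_dist_lt _ R^o) e3; exact: ch.
  rewrite (hC x Cx) sub0r normrN => hy.
  rewrite /psi (hC x Cx) mul0r addr0 opprD addrA.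
  apply: le_lt_trans (ler_normB _ _) _.
  rewrite (splitr e) ltrD// normrM.
  have /andP[hy0 hy1] := h01 y.
  move: hy; rewrite ger0_norm// ltr_pdivlMr// => hy.
  apply: le_lt_trans hy; exact: ler_wpM2l.
exists psi, (gap / 2); split => //.
- move=> x; rewrite /psi addrC addKr normrM.
  have /andP[h0 h1] := h01 x.
  by rewrite ger0_norm// -[leRHS]mul1r ler_pM.
- by rewrite divr_gt0.
move=> mu muinv t.
have mslab : measurable (slab psi t (gap / 2) : set T).
  by apply: open_measurable_Borel; exact: open_slab.
(* The gap leaves room for at most one index [i] with [c i] close to [t]. *)
have [[i [ni cit]]|nc] :=
    pselect (exists i, (i < n)%N /\ `|c i - t| < gap / 2); last first.
  apply: le_trans (_ : _ <= mu W)%E _; last first.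
    by apply: le_trans (ltW (muW _ muinv)) _; rewrite lee_fin; lra.
  apply: measure_le => //; first exact: open_measurable_Borel.
  move=> x xt; apply: contrapT => nWx; apply: nc; exists (idx x); split => //.
  by move: xt; rewrite /slab /= psiW//.
have [oUi _ _ _ /(_ _ muinv) muUi] := UP (pt i).
have mU : measurable (U (pt i) : set T) by exact: open_measurable_Borel.
have mW : measurable (W : set T) by exact: open_measurable_Borel.
apply: le_trans (_ : _ <= mu (W `|` U (pt i)))%E _.
  apply: measure_le => //; first exact: measurableU.
  move=> x xt; have [Wx|nWx] := pselect (W x); [by left|right].
  suff <- : idx x = i by exact: idxU.
  apply: contrapT => nidx.
  have := cgap _ _ (idx_lt x) ni nidx.
  move: xt; rewrite /slab /= psiW// => xt.
  rewrite leNgt => /negP; apply.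
  rewrite (splitr gap) (_ : c (idx x) - c i = (c (idx x) - t) + (t - c i)); last first.
    by rewrite addrA subrK.
  by apply: le_lt_trans (ler_normD _ _) _; rewrite ltrD// distrC.
apply: le_trans (measureU2 _ mW mU) _.
by rewrite (splitr eps) EFinD leeD// ltW// muW.
Unshelve. all: by end_near. Qed.

(** The limit of a sequence of perturbations [u n], each with a tolerance [e n]
    chosen so that, for [n > 0], the slabs of width [e n] of any function
    within [e n] of [u n] are small. *)
Lemma diffuse_function (phi0 : X -> R) (eta : R) : continuous phi0 -> 0 < eta ->
  exists phi : X -> R, [/\ continuous phi, forall x, `|phi x - phi0 x| <= eta &
    forall eps, 0 < eps -> exists2 delta, 0 < delta &
      forall mu : probability T R, invariant_measures a mu ->
        forall t, (mu (slab phi t delta) <= eps%:E)%E].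
Proof.
move=> cphi0 eta0.
pose ok (p : (X -> R) * R) := continuous p.1 /\ 0 < p.2.
pose next n (p q : (X -> R) * R) := [/\ ok q,
  forall x, `|q.1 x - p.1 x| <= p.2 / 2, q.2 <= p.2 / 2 &
  forall mu : probability T R, invariant_measures a mu -> forall t,
    (mu (slab q.1 t (2 * q.2)) <= (n.+1%:R^-1)%:E)%E].
have step (np : nat * ((X -> R) * R)) : exists q, ok np.2 -> next np.1 np.2 q.
  case: np => n p /=; have [[cp p0]|nok] := pselect (ok p); last by exists p.
  have p2 : 0 < p.2 / 2 by rewrite divr_gt0.
  have n0 : 0 < n.+1%:R^-1 :> R by rewrite invr_gt0.
  have [psi [delta [cpsi psip d0 dmu]]] :=
    diffuse_perturbation cp p2 n0.
  exists (psi, Num.min (p.2 / 2) (delta / 2)) => _; split => //=.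
  - by split => //=; rewrite lt_min p2 divr_gt0.
  - by rewrite ge_min lexx.
  - move=> mu muinv t; apply: le_trans (dmu mu muinv t).
    apply: measure_le; try by apply: open_measurable_Borel; exact: open_slab.
    move=> x; rewrite /slab /= => /lt_le_trans; apply.
    by rewrite mulrC -ler_pdivlMr// ge_min lexx orbT.
have [f fP] := choice step.
pose s := fix s n := if n is n'.+1 then f (n', s n') else (phi0, eta).
have sok n : ok (s n) by elim: n => [//|n IH]; have [] := fP (n, s n) IH.
have snext n : next n (s n) (s n.+1) by exact: fP (n, s n) (sok n).
pose u n := (s n).1; pose e n := (s n).2.
have e0 n : 0 < e n by have [] := sok n.
have cu n : continuous (u n) by have [] := sok n.
have uS n x : `|u n.+1 x - u n x| <= e n - e n.+1.
  have [_ /(_ x) h1 h2 _] := snext n; apply: le_trans h1 _.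
  by rewrite lerBrDr -/(e n.+1) (splitr (e n)) lerD2l.
have u_sub n k x : `|u (n + k)%N x - u n x| <= e n - e (n + k)%N.
  elim: k => [|k IH]; first by rewrite addn0 !subrr normr0.
  rewrite addnS; have := uS (n + k)%N x; move: IH.
  by rewrite !ler_norml => /andP[? ?] /andP[? ?]; apply/andP; split; lra.
have ehalf n : e n <= eta / 2 ^+ n.
  elim: n => [|n IH]; first by rewrite expr0 divr1.
  have [_ _ h _] := snext n; apply: le_trans h _.
  by rewrite exprSr invfM mulrA ler_pM2r.
(* The intervals [[u n x - e n, u n x + e n]] are nested; [phi x] is the
   supremum of their lower ends. *)
have ulu n k x : u n x - e n <= u k x + e k.
  have [nk|/ltnW kn] := leqP n k.
    have := u_sub n (k - n)%N x; rewrite subnKC// ler_norml => /andP[h _].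
    have := e0 k; lra.
  have := u_sub k (n - k)%N x; rewrite subnKC// ler_norml => /andP[_ h].
  have := e0 n; lra.
pose phi x := sup [set u n x - e n | n in [set: nat]].
have phi_near n x : `|phi x - u n x| <= e n.
  have ub m : ubound [set u n x - e n | n in [set: nat]] (u m x + e m).
    by move=> _ [k _ <-].
  have ne : [set u n x - e n | n in [set: nat]] !=set0.
    by exists (u 0%N x - e 0%N), 0%N.
  rewrite ler_distl; apply/andP; split.
    apply: sup_upper_bound; last by exists n.
    by split => //; exists (u 0%N x + e 0%N).
  exact: ge_sup.
have cphi : continuous phi.
  move=> x; apply/cvgrPdist_lt => r r0.
  have r3 : 0 < r / 3 by rewrite divr_gt0.
  have [n ern] : exists n, e n < r / 3.
    have [n ren] : exists n, eta / (r / 3) < 2 ^+ n.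
      exists (Num.truncn (eta / (r / 3))).+1.
      apply: lt_trans (truncnS_gt _) _.
      by rewrite -natrX ltr_nat ltn_expl.
    exists n; apply: le_lt_trans (ehalf n) _.
    by rewrite ltr_pdivrMr ?exprn_gt0// mulrC -ltr_pdivrMr.
  near=> y.
  have uxy : `|u n x - u n y| < r / 3.
    near: y; apply: (@cvgr_dist_lt _ R^o) r3; exact: cu.
  have := phi_near n x; have := phi_near n y; move: uxy ern.
  rewrite !ltr_norml !ler_norml => /andP[? ?] ? /andP[? ?] /andP[? ?].
  by apply/andP; split; lra.
exists phi; split => //.
- exact: phi_near 0%N.
- move=> eps eps0; pose n := Num.truncn eps^-1.
  exists (e n.+1) => // mu muinv t.
  have [_ _ _ /(_ mu muinv t) h] := snext n.
  apply: le_trans (_ : _ <= mu (slab (u n.+1) t (2 * e n.+1)))%E _.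
    apply: measure_le.
    + by apply: open_measurable_Borel; exact: open_slab.
    + by apply: open_measurable_Borel; exact: open_slab.
    + move=> x; rewrite /slab /= => xt.
      have := phi_near n.+1 x; move: xt; rewrite !ltr_norml !ler_norml.
      by move=> /andP[? ?] /andP[? ?]; apply/andP; split; lra.
  apply: le_trans h _; rewrite lee_fin.
  rewrite -[leRHS]invrK lef_pV2 ?posrE ?invr_gt0//.
  by rewrite ltW// truncnS_gt.
Unshelve. all: by end_near. Qed.

End diffuse_functions.

(** * Conditioning and pushing forward invariant measures *)

(** Conditioning a measure [mu] on a set [E] and pushing the result forward along
    [f] gives an invariant probability measure if each translation of [Z] lifts
    along [f] to a map that preserves [mu] and [E]. *)
Lemma conditional_pushforward (R : realType) (X Z : topologicalType)
    (K : groupType) (c : continuous_action K Z) (x0 : X) (z0 : Z)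
    (mu : {measure set (Borel x0) -> \bar R}) (E : set X) (f : X -> Z) :
  measurable (E : set (Borel x0)) -> mu E != 0%E -> (mu E < +oo)%E ->
  continuous f ->
  (forall k, exists theta : X -> X, [/\
    forall A : set (Borel x0), measurable A -> mu (theta @^-1` A) = mu A,
    theta @^-1` E = E & forall x, f (theta x) = c k (f x)]) ->
  exists2 nu : probability (Borel z0) R, invariant_measures c nu &
    forall B : set (Borel z0), measurable B ->
      (nu B * mu E = mu (f @^-1` B `&` E))%E.
Proof.
move=> mE muE muEoo cf equi.
have muEfin : mu E \is a fin_num by rewrite ge0_fin_numE.
have mf := continuous_preimage_measurable (x0 := x0) (z0 := z0) cf.
pose f0 : Borel x0 -> Borel z0 := f.
pose mf0 := isMeasurableFun.Build _ _ (Borel x0) (Borel z0) f0 mf.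
pose f' : {mfun (Borel x0) >-> (Borel z0)} := HB.pack f0 mf0.
pose nu : probability (Borel z0) R :=
  distribution (mnormalize (mrestr mu mE) (@dirac _ (Borel x0) x0 R)) f'.
have nuE (B : set (Borel z0)) :
    nu B = (mu (f @^-1` B `&` E) * (fine (mu E))^-1%:E)%E.
  have evidence : mrestr mu mE setT = mu E by congr (mu _); exact: setTI.
  rewrite /nu /= /distribution /pushforward /mnormalize /= evidence ifF//.
  apply/negbTE; rewrite negb_or; apply/andP; split.
    by apply: contra muE.
  by rewrite lt_eqF.
exists nu.
  move=> k A mA; rewrite !nuE; congr (_ * _)%E.
  have [theta [mtheta Etheta ftheta]] := equi k.
  have mfA : measurable (f @^-1` A : set (Borel x0)).
    by have := mf measurableT A mA; rewrite setTI.
  rewrite -(mtheta (f @^-1` A `&` E)); last exact: measurableI.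
  rewrite preimage_setI Etheta; congr (mu (_ `&` _)).
  by apply/seteqP; split => x /=; rewrite ftheta.
move=> B mB; rewrite nuE -muleA -{2}[mu E]fineK// -EFinM.
by rewrite mulVf ?mule1// fine_eq0.
Qed.

(** * Products with an action without finite orbits *)

Section products.
Context (R : realType) (G H : groupType) (X Y : topologicalType).
Context (a : continuous_action G X) (b : continuous_action H Y).

(** Lift the translation by [g] to the action of [(g, 1)], which preserves the
    second coordinate. *)
Lemma product_fst_conditional (p0 : X * Y) (nu : probability (Borel p0) R)
    (x0 : X) (F : set Y) :
  invariant_measures (prod_action a b) nu ->
  measurable (snd @^-1` F : set (Borel p0)) -> nu (snd @^-1` F) != 0%E ->
  exists2 mu : probability (Borel x0) R, invariant_measures a mu &
    forall A : set (Borel x0), measurable A ->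
      (mu A * nu (snd @^-1` F) = nu (fst @^-1` A `&` snd @^-1` F))%E.
Proof.
move=> nuinv mF nuF.
apply: (@conditional_pushforward R _ _ _ a p0 x0 nu (snd @^-1` F) fst) => //.
  by rewrite ltey_eq fin_num_measure.
  by move=> p; exact: cvg_fst.
move=> g; exists (prod_action a b (g, 1%g)); split=> //.
- by move=> A mA; exact: nuinv.
- by apply/seteqP; split => p /=; rewrite act1.
Qed.

Lemma closed_graph_eq (phi : X -> R) (f : Y -> R) :
  continuous phi -> continuous f -> closed [set p : X * Y | phi p.1 = f p.2].
Proof.
move=> cphi cf.
rewrite (_ : mkset _ = (fun p => phi p.1 - f p.2) @^-1` [set 0]); last first.
  apply/seteqP; split => p /=; first by move=> ->; rewrite subrr.
  by move=> /subr0_eq.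
apply: preimage_closed; last exact: closed_eq.
move=> p _; apply: cvgB.
  by apply: continuous_comp; [exact: cvg_fst|exact: cphi].
by apply: continuous_comp; [exact: cvg_snd|exact: cf].
Qed.

(** The coincidence set of a diffuse [phi], bounded above, and of a nonnegative
    function [f] of the second coordinate is null for every invariant measure
    of the product. *)
Lemma diffuse_graph_null (p0 : X * Y) (nu : probability (Borel p0) R)
    (x0 : X) (phi : X -> R) (f : Y -> R) (r : R) :
  invariant_measures (prod_action a b) nu ->
  continuous phi -> continuous f ->
  (forall y, 0 <= f y) -> (forall x, phi x < r) ->
  (forall eps, 0 < eps -> exists2 delta, 0 < delta &
      forall mu : probability (Borel x0) R, invariant_measures a mu ->
        forall t, (mu (slab phi t delta) <= eps%:E)%E) ->
  nu [set p | phi p.1 = f p.2] = 0%E.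
Proof.
move=> nuinv cphi cf f0 phir diffuse.
set L := [set p | _].
have cfst : continuous (@fst X Y) by move=> p; exact: cvg_fst.
have csnd : continuous (@snd X Y) by move=> p; exact: cvg_snd.
have mL : measurable (L : set (Borel p0)).
  by apply: closed_measurable_Borel; exact: closed_graph_eq.
have mlt t : measurable (snd @^-1` [set y | f y < t] : set (Borel p0)).
  apply: open_measurable_Borel.
  rewrite (_ : _ @^-1` _ = (fun p => f p.2) @^-1` [set s | s < t])//.
  apply: open_comp; last exact: open_lt.
  by move=> p _; apply: continuous_comp; [exact: csnd|exact: cf].
apply/eqP; rewrite eq_le measure_ge0 andbT; apply/lee_addgt0Pr => eps eps0.
rewrite add0e; have [delta delta0 small_slab] := diffuse eps eps0.
pose F n := snd @^-1` [set y | f y < n%:R * delta] : set (X * Y).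
have mF n : measurable (F n : set (Borel p0)) by exact: mlt.
have nuF n : (nu (L `&` F n) <= eps%:E * nu (F n))%E.
  elim: n => [|n IH].
    rewrite (_ : F 0%N = set0) ?setI0 ?measure0 ?mule0//.
    apply/seteqP; split => // p; rewrite /F /= mul0r => fp.
    by have := f0 p.2; rewrite leNgt fp.
  (* On [L] above [E], [phi] is [delta]-close to [n * delta]. *)
  pose E := [set y | n%:R * delta <= f y < n.+1%:R * delta].
  have FE : F n.+1 = F n `|` snd @^-1` E.
    apply/seteqP; split => p; rewrite /F /E /=.
      by move=> h; have [h'|h'] := ltP (f p.2) (n%:R * delta);
        [left|right; apply/andP].
    move=> [h|/andP[]//]; apply: lt_trans h _.
    by rewrite ltr_pM2r// ltr_nat.
  have mE : measurable (snd @^-1` E : set (Borel p0)).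
    rewrite (_ : _ @^-1` _ = F n.+1 `\` F n); first exact: measurableD.
    apply/seteqP; split => p; rewrite /F /E /=.
      by move=> /andP[h1 h2]; split => //; apply/negP; rewrite -leNgt.
    by move=> [h1 /negP]; rewrite -leNgt => h2; rewrite h1 h2.
  have nuE : (nu (L `&` snd @^-1` E) <= eps%:E * nu (snd @^-1` E))%E.
    have mLE : measurable (L `&` snd @^-1` E : set (Borel p0)) by exact: measurableI.
    have [nuE0|nuE0] := eqVneq (nu (snd @^-1` E)) 0%E.
      by rewrite nuE0 mule0 -nuE0; apply: measure_le.
    have [mu muinv muE] := product_fst_conditional x0 nuinv mE nuE0.
    have mslab : measurable (slab phi (n%:R * delta) delta : set (Borel x0)).
      by apply: open_measurable_Borel; exact: open_slab.
    apply: le_trans (_ : _ <= nu (fst @^-1` slab phi (n%:R * delta) delta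
                                 `&` snd @^-1` E))%E _.
      apply: measure_le => //.
        apply: measurableI => //; apply: open_measurable_Borel.
        by apply: open_comp; [move=> p _; exact: cfst|exact: open_slab].
      move=> p [Lp Ep]; split => //; move: Lp Ep; rewrite /L /E /slab /= => ->.
      rewrite -natr1 mulrDl mul1r => /andP[h1 h2].
      by rewrite ger0_norm ?subr_ge0// ltrBlDl.
    by rewrite -muE//; apply: lee_wpmul2r; [exact: measure_ge0|exact: small_slab].
  rewrite FE setIUr.
  have mLF : measurable (L `&` F n : set (Borel p0)) by exact: measurableI.
  have mLE : measurable (L `&` snd @^-1` E : set (Borel p0)) by exact: measurableI.
  apply: le_trans (measureU2 nu mLF mLE) _.
  rewrite measureU//; last first.
    by apply/seteqP; split => // p; rewrite /F /E /= => -[h1] /andP[]; rewrite leNgt h1.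
  by rewrite ge0_muleDr ?measure_ge0// leeD.
pose n := (Num.truncn (r / delta)).+1.
have LF : L `<=` L `&` F n.
  move=> p Lp; split => //; rewrite /F /= -Lp; apply: lt_le_trans (phir _) _.
  by rewrite -ler_pdivrMr// ltW// truncnS_gt.
apply: le_trans (_ : _ <= nu (L `&` F n))%E _.
  by apply: measure_le => //; exact: measurableI.
apply: le_trans (nuF n) _.
rewrite -[leRHS]mule1; apply: lee_wpmul2l; first by rewrite lee_fin ltW.
exact: probability_le1.
Qed.

Lemma SBP_product :
  small_boundary_property R a -> no_finite_orbits a ->
  compact_metrizable R X -> compact_metrizable R Y ->
  small_boundary_property R (prod_action a b).
Proof.
move=> aSBP ainf [cX mX] [_ [d [d0 dC dD dnbhs]]].
have hX := metrizable_hausdorff mX.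
exists [set U | open U /\ small R (prod_action a b) (boundary U)]; last by move=> U [].
split=> [U []//|[x y] W [[A B] [/= xA yB] ABW]].
have [V0 [V0open V0nbhs] V0small] := aSBP.
have [V [V0V Vx] VA] := V0nbhs x A xA.
have oV : open V by exact: V0open.
have : nbhs y B by [].
rewrite dnbhs => -[r /= r0 rB].
have r2 : 0 < r / 4 by rewrite divr_gt0.
have [phi [cphi phir diffuse]] :=
  diffuse_function x hX cX aSBP ainf (@cst_continuous X R (r / 2)) r2.
have phi0 z : 0 < phi z.
  by have := phir z; rewrite ler_distl /= => /andP[? ?]; lra.
have phi_lt z : phi z < r.
  by have := phir z; rewrite ler_distl /= => /andP[? ?]; lra.
have cd := metric_continuous dC dD dnbhs (x := y).
have cfst : continuous (@fst X Y) by move=> p; exact: cvg_fst.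
have csnd : continuous (@snd X Y) by move=> p; exact: cvg_snd.
pose gap (p : X * Y) := phi p.1 - d y p.2.
have cgap : continuous gap.
  move=> p; apply: cvgB.
    by apply: continuous_comp; [exact: cfst|exact: cphi].
  by apply: continuous_comp; [exact: csnd|exact: cd].
pose U := fst @^-1` V `&` gap @^-1` [set t | 0 < t].
have oU : open U.
  apply: openI; first by apply: open_comp.
  by apply: open_comp; [move=> p _; exact: cgap|exact: open_gt].
exists U; last first.
  move=> [u v] [/= Vu]; rewrite /gap /= subr_gt0 => yv; apply: ABW; split.
    exact: VA.
  by apply: rB => /=; exact: lt_trans (phi_lt u).
split; last by split => //; rewrite /gap /= (d0 y y).2// subr0.
split => // p0 nu nuinv.
have Usub : boundary U `<=` fst @^-1` boundary V `|` [set p | phi p.1 = d y p.2].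
  move=> p [clUp nUp].
  have clV : closure V p.1.
    have : closed (fst @^-1` closure V : set (X * Y)).
      by apply: preimage_closed; [move=> q _; exact: cfst|exact: closed_closure].
    move/closure_id => cl; suff : (fst @^-1` closure V) p by [].
    rewrite cl; apply: closureS clUp => q [Vq _].
    exact: subset_closure.
  have gap_ge0 : 0 <= gap p.
    have : closed (gap @^-1` [set t | 0 <= t]).
      by apply: preimage_closed; [move=> q _; exact: cgap|exact: closed_ge].
    move/closure_id => cl; suff : (gap @^-1` [set t | 0 <= t]) p by [].
    by rewrite cl; apply: closureS clUp => q [_ /ltW].
  have [Vp|nVp] := pselect (V p.1); last first.
    by left; split => // /interior_subset.
  right; apply/eqP; rewrite -subr_eq0 -/(gap p) eq_le gap_ge0 andbT leNgt.
  by apply/negP => gp; apply: nUp; move: oU; rewrite openE; apply.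
have mbU : measurable (boundary U : set (Borel p0)).
  by apply: closed_measurable_Borel; exact: boundary_closed.
have mbV : measurable (fst @^-1` boundary V : set (Borel p0)).
  apply: closed_measurable_Borel; apply: preimage_closed.
    by move=> q _; exact: cfst.
  exact: boundary_closed.
have mL : measurable ([set p | phi p.1 = d y p.2] : set (Borel p0)).
  by apply: closed_measurable_Borel; exact: closed_graph_eq.
apply/eqP; rewrite eq_le measure_ge0 andbT.
apply: le_trans (measure_le nu mbU (measurableU _ _ mbV mL) Usub) _.
apply: le_trans (_ : _ <= nu (fst @^-1` boundary V) +
    nu [set p | phi p.1 = d y p.2])%E _; first exact: measureU2.
have muT : nu (snd @^-1` setT) != 0%E.
  by rewrite preimage_setT probability_setT.
have [mu muinv muE] := product_fst_conditional x nuinv measurableT muT.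
have -> : nu (fst @^-1` boundary V) = 0%E.
  have := muE (boundary V) _; rewrite preimage_setT setIT => <-.
    by rewrite V0small// mul0e.
  by apply: closed_measurable_Borel; exact: boundary_closed.
rewrite add0e (diffuse_graph_null (x0 := x) nuinv cphi cd _ phi_lt)//.
by move=> z; exact: metric_ge0 d0 dC dD y z.
Qed.

End products.

(** * A connected compact metrizable space *)

Section extended_line.
Context (R : realType).
Local Open Scope ring_scope.

(* A continuous map of [R] to [\bar R], one-to-one from [[-1, 1]] onto
   [\bar R]. *)
Let emb (t : R) : \bar R := expand (Num.max (-1) (Num.min 1 t)).

Let clamp_dist (u v : R) :
  `|Num.max (-1) (Num.min 1 u) - Num.max (-1) (Num.min 1 v)| <= `|u - v|.
Proof.
have m1 : Num.max (-1) 1 = 1 :> R by apply/max_idPr; lra.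
have := ler_norm (u - v); have := ler_norm (v - u); rewrite (distrC v u).
case: (leP 1 u) => u1; case: (leP 1 v) => v1;
  rewrite ?m1; case: (leP (-1) u) => ?; case: (leP (-1) v) => ?;
  rewrite ler_norml => ? ?; apply/andP; split; lra.
Qed.

Let contract_emb t : contract (emb t) = Num.max (-1) (Num.min 1 t).
Proof.
rewrite /emb expandK// inE ler_norml.
by rewrite le_max lexx /= ge_max ge_min lexx /= andbT; lra.
Qed.

Let emb_continuous : continuous emb.
Proof.
move=> t W; rewrite -nbhs_ballE => -[e /= e0 eW].
apply/nbhs_ballP; exists e => //= s ts; apply: eW.
rewrite /ball /= /ereal_ball (contract_emb t) (contract_emb s).
by apply: le_lt_trans ts; exact: clamp_dist.
Qed.

Let emb_segment : emb @` `[-1, 1]%classic = [set: \bar R].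
Proof.
apply/seteqP; split => // y _; exists (contract y).
  by rewrite /= in_itv /= -ler_norml contract_le1.
have := contract_le1 y; rewrite ler_norml => /andP[h1 h2].
by rewrite /emb (min_idPr h2) (max_idPr h1) contractK.
Qed.

Lemma ereal_compact_metrizable : compact_metrizable R (\bar R).
Proof.
split.
  rewrite -emb_segment; apply: continuous_compact; last exact: segment_compact.
  exact: continuous_subspaceT.
exists (fun x y => `|contract x - contract y|); split.
- move=> x y; split=> [/normr0_eq0/subr0_eq/(can_inj (@contractK R))//|->].
  by rewrite subrr normr0.
- by move=> x y; rewrite distrC.
- by move=> x y z; exact: ler_distD.
- by move=> x; rewrite -nbhs_ballE.
Qed.

Lemma ereal_connected : connected [set: \bar R].
Proof.
rewrite -emb_segment; apply: connected_continuous_connected.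
  exact: segment_connected.
exact: continuous_subspaceT.
Qed.

End extended_line.

(** * Necessity *)

Section trivial_action.
Context (X : topologicalType).

(** The trivial action of the trivial group ['S_1]. *)
Definition trivial_act (g : 'S_1) (x : X) := x.

Lemma trivial_act1 x : trivial_act 1%g x = x. Proof. by []. Qed.

Lemma trivial_actM g h x :
  trivial_act (g * h)%g x = trivial_act g (trivial_act h x).
Proof. by []. Qed.

Lemma trivial_act_continuous g : continuous (trivial_act g).
Proof. by move=> x. Qed.

Definition trivial_action : continuous_action 'S_1 X :=
  ContAction trivial_act1 trivial_actM trivial_act_continuous.

End trivial_action.

(** What can be deduced on [a] from the product with the trivial action on the
    extended real line. *)
Section factors.
Context (R : realType) (G : groupType) (X : topologicalType).
Context (a : continuous_action G X).
Hypothesis X_hausdorff : hausdorff_space X.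
Hypothesis a_products : products_have_SBP R a.

Let a_bar_SBP :
  small_boundary_property R (prod_action a (trivial_action (\bar R))).
Proof.
by apply: a_products; [exact: countableP|exact: ereal_compact_metrizable].
Qed.

Let slice_continuous (y : \bar R) : continuous (fun x : X => (x, y)).
Proof. by move=> x; apply: cvg_pair => //=; exact: cvg_cst. Qed.

Let slice_equivariant (y : \bar R) g x :
  (a g.1 x, y) = prod_action a (trivial_action (\bar R)) g (x, y).
Proof. by []. Qed.

Lemma products_have_SBP_factor : small_boundary_property R a.
Proof.
have [B [Bopen Bnbhs] Bsmall] := a_bar_SBP.
pose y0 : \bar R := 0%E.
pose f (x : X) := (x, y0).
have cf : continuous f by exact: slice_continuous.
exists [set f @^-1` U | U in B].
  split; first by move=> _ [U BU <-]; apply: open_comp => //; exact: Bopen.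
  move=> x W xW.
  have : nbhs (f x) (fst @^-1` W) by exact: (@cvg_fst _ _ (nbhs x) (nbhs y0) _ W xW).
  move=> /Bnbhs[U [BU Ux] UW]; exists (f @^-1` U); first by split => //; exists U.
  by move=> z /UW.
move=> _ [U BU <-] x0 mu muinv.
have muT : mu setT != 0%E by rewrite probability_setT.
have muoo : (mu setT < +oo)%E by rewrite probability_setT ltry.
have [nu nuinv nuE] := @conditional_pushforward R _ _ _
  (prod_action a (trivial_action (\bar R))) x0 (f x0) mu setT f
  measurableT muT muoo cf
  (fun g => ex_intro _ (a g.1) (And3 (muinv g.1) erefl (slice_equivariant y0 g))).
have mU : measurable (boundary U : set (Borel (f x0))).
  by apply: closed_measurable_Borel; exact: boundary_closed.
apply/eqP; rewrite eq_le measure_ge0 andbT.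
apply: le_trans (_ : _ <= mu (f @^-1` boundary U `&` setT))%E _.
  rewrite setIT; apply: measure_le.
  - by apply: closed_measurable_Borel; exact: boundary_closed.
  - apply: closed_measurable_Borel; apply: preimage_closed.
      by move=> z _; exact: cf.
    exact: boundary_closed.
  - exact: boundary_preimage.
by rewrite -nuE// Bsmall// mul0e.
Qed.

Lemma products_have_SBP_no_finite_orbits : no_finite_orbits a.
Proof.
move=> x fin_orbit.
have [B [Bopen Bnbhs] Bsmall] := a_bar_SBP.
have : nbhs (x, -oo%E) (snd @^-1` [set y : \bar R | (y < 0)%E] : set (X * \bar R)).
  apply: (@cvg_snd _ _ (nbhs x) (nbhs (-oo%E : \bar R))).
  by exists 0; split => // y; rewrite lte_fin.
move=> /Bnbhs[U [BU Ux] UW].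
pose D := [set y | U (x, y)].
have orbx : act_orbit a x x by exists 1%g => //; exact: act1.
have cx : continuous (fun y : \bar R => (x, y)).
  by move=> y; apply: cvg_pair => //=; exact: cvg_cst.
have oD : open D by apply: open_comp => //; exact: Bopen.
have nbU y : ~ boundary U (x, y).
  move=> bU.
  pose f (x : X) := (x, y).
  have mO : measurable (act_orbit a x : set (Borel x)).
    apply: closed_measurable_Borel; apply: accessible_finite_set_closed.1 => //.
    exact: hausdorff_accessible.
  (* The uniform measure on the orbit is the conditioned counting measure; it is
     pushed to [X * {y}]. *)
  pose nu0 : {measure set (Borel x) -> \bar R} := @counting (Borel x) R.
  have cO : nu0 (act_orbit a x) != 0%E.
    exact: counting_neq0 orbx.
  have fO : (nu0 (act_orbit a x) < +oo)%E.
    by rewrite /nu0 /= /counting asboolT// ltry.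
  have equi g : exists theta : X -> X,
    [/\ forall A : set (Borel x), measurable A -> nu0 (theta @^-1` A) = nu0 A,
      theta @^-1` act_orbit a x = act_orbit a x &
      forall x, f (theta x) = prod_action a (trivial_action (\bar R)) g (f x)].
    exists (a g.1); split => //.
    - move=> A _; apply: counting_preimage; first exact: act_inv_cancel.
      exact: act_cancel_inv.
    - apply/seteqP; split => z /= [k _].
        move=> kz; exists (g.1^-1 * k)%g => //.
        by rewrite actM kz act_inv_cancel.
      by move=> <-; exists (g.1 * k)%g => //; rewrite actM.
  have [nu nuinv nuE] := conditional_pushforward (f x) mO cO fO
    (slice_continuous (y := y)) equi.
  have mU : measurable (boundary U : set (Borel (f x))).
    by apply: closed_measurable_Borel; exact: boundary_closed.
  have := nuE _ mU; rewrite Bsmall// mul0e => /esym/eqP.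
  by apply/negP; apply: (@counting_neq0 R (Borel x) _ x).
have cD : closed D.
  rewrite (_ : D = (fun y => (x, y)) @^-1` closure U).
    by apply: preimage_closed; [move=> y _; exact: cx|exact: closed_closure].
  apply/seteqP; split => y; first by move=> Dy; apply: subset_closure.
  move=> clU; apply: contrapT => nDy; apply: (nbU y); split => //.
  by move=> /interior_subset.
have : D = [set: \bar R].
  apply: (@ereal_connected R) => //.
  - by exists -oo%E.
  - by exists D => //; rewrite setTI.
  - by exists D => //; rewrite setTI.
move=> DT; have : [set: \bar R] +oo%E by [].
by rewrite -DT => /UW.
Qed.

End factors.

Lemma minimal_no_finite_orbits (G : groupType) (X : topologicalType)
    (a : continuous_action G X) : hausdorff_space X ->
  infinite_set [set: X] -> minimal_action a -> no_finite_orbits a.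
Proof.
move=> hX infX mina x fin_orbit; apply: infX.
have cO : closed (act_orbit a x).
  apply: accessible_finite_set_closed.1 => //; exact: hausdorff_accessible.
suff E : act_orbit a x = [set: X] by rewrite -E.
apply/seteqP; split => // y _; apply: contrapT => ny.
have [|z [nz Oz]] := mina x (~` act_orbit a x) _ (closed_openC cO).
  by exists y.
exact: nz.
Qed.

Theorem theorem1 (R : realType) (G : groupType) (X : topologicalType)
    (a : continuous_action G X)
    (G_countable : countable [set: G])
    (X_compact_metrizable : compact_metrizable R X) :
  (small_boundary_property R a /\ no_finite_orbits a
     <-> products_have_SBP R a) /\
  (infinite_set [set: G] -> infinite_set [set: X] ->
   minimal_action a -> small_boundary_property R a ->
   products_have_SBP R a).
Proof.
have hX := metrizable_hausdorff X_compact_metrizable.2.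
have to_products : small_boundary_property R a -> no_finite_orbits a ->
    products_have_SBP R a.
  by move=> aSBP ainf H Y b _ cmY; exact: SBP_product.
split; first split=> [[]//|a_products].
  split; first exact: products_have_SBP_factor.
  exact: products_have_SBP_no_finite_orbits a_products.
move=> _ infX mina aSBP; apply: to_products => //.
exact: minimal_no_finite_orbits.
Qed.
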